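(* Let $\mathbb F$ be a field, $n\in\mathbb N$, $n\ge 1$, and $A,B,F,G\in\mathcal M_n(\mathbb F)$. Assume that the $2n\times 2n$ block matrices $$\begin{pmatrix}F&G\\ B&A\end{pmatrix}\quad\text{and}\quad\begin{pmatrix}A&B\\ G&F\end{pmatrix}$$ are invertible. For $k\in\mathbb Z$ define $$M(k):=\left(\left[-\begin{pmatrix}F&G\\ B&A\end{pmatrix}^{-1}\begin{pmatrix}A&B\\ G&F\end{pmatrix}\right]^k\right)_{(1)}+\left(\left[-\begin{pmatrix}F&G\\ B&A\end{pmatrix}^{-1}\begin{pmatrix}A&B\\ G&F\end{pmatrix}\right]^k\right)_{(2)}\in\mathcal M_n(\mathbb F).$$ Then $M=(M(k))_{k\in\mathbb Z}$ is a fundamental matrix of the system $$Fx_{k+1}+Gx_{-k-1}+Ax_k+Bx_{-k}=0,\quad k\in\mathbb Z,\qquad(x_k\in\mathbb F^n).$$ Furthermore, for every $u_0\in\mathbb F^n$ this system together with the condition $x_0=u_0$ has a unique solution, given by $(u_k)_{k\in\mathbb Z}=(M(k)u_0)_{k\in\mathbb Z}$.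
   Context: For a $2n\times2n$ matrix $N=\begin{pmatrix}N_1&N_2\\ N_3&N_4\end{pmatrix}$ with blocks $N_i\in\mathcal M_n(\mathbb F)$, we write $N_{(i)}:=N_i$; so $N_{(1)}$ is the upper left and $N_{(2)}$ the upper right block. A function $M:\mathbb Z\to\mathcal M_n(\mathbb F)$ is a fundamental matrix of the system $Fx_{k+1}+Gx_{-k-1}+Ax_k+Bx_{-k}=0$, $k\in\mathbb Z$, if $(M(k)u_0)_{k\in\mathbb Z}$ is a solution for every $u_0\in\mathbb F^n$, that is, $FM(k+1)+GM(-k-1)+AM(k)+BM(-k)=0$ for all $k\in\mathbb Z$. *)

(* Defs.v *)
From mathcomp Require Import all_boot all_order all_algebra.

Set Implicit Arguments.
Unset Strict Implicit.
Unset Printing Implicit Defensive.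

Import GRing.Theory.
Local Open Scope ring_scope.

(* Sizes are written n.+1, so that n >= 1 is built in and the square matrices
   form a unitRingType, on which the integer power S ^ k is defined. *)

Definition is_solution (K : fieldType) (n : nat) (F G A B : 'M[K]_n.+1)
    (x : int -> 'cV[K]_n.+1) : Prop :=
  forall k : int,
    F *m x (k + 1) + G *m x (- k - 1) + A *m x k + B *m x (- k) = 0.

Definition is_fundamental_matrix (K : fieldType) (n : nat)
    (F G A B : 'M[K]_n.+1) (M : int -> 'M[K]_n.+1) : Prop :=
  forall u0 : 'cV[K]_n.+1, is_solution F G A B (fun k => M k *m u0).

Definition step_mx (K : fieldType) (n : nat) (F G A B : 'M[K]_n.+1) :
    'M[K]_(n.+1 + n.+1) :=
  - (invmx (block_mx F G B A) *m block_mx A B G F).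

(* The unit ring structure is found at the size (n + n.+1).+1, which is
   convertible to n.+1 + n.+1. *)
Definition step_mx_pow (K : fieldType) (n : nat) (F G A B : 'M[K]_n.+1)
    (k : int) : 'M[K]_(n.+1 + n.+1) :=
  @exprz 'M[K]_((n + n.+1).+1) (step_mx F G A B) k.

Definition fund_mx (K : fieldType) (n : nat) (F G A B : 'M[K]_n.+1)
    (k : int) : 'M[K]_n.+1 :=
  ulsubmx (step_mx_pow F G A B k) + ursubmx (step_mx_pow F G A B k).

(* Main.v *)
Require Import Defs.
From mathcomp Require Import all_boot all_order all_algebra.

Set Implicit Arguments.
Unset Strict Implicit.
Unset Printing Implicit Defensive.

Import GRing.Theory.
Local Open Scope ring_scope.

(** The reflection [k |-> - k] is absorbed by doubling the state: put
    [z k := col_mx (x k) (x (- k))], [P := block_mx F G B A] and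
    [Q := block_mx A B G F].  The system at [k] and at [- k - 1] are the two
    block rows of the first-order equation [P z(k+1) + Q z(k) = 0]
    ([is_solution_pair]).  As [P] and [Q] are invertible, this equation
    has exactly one solution with a given [z 0], namely
    [z k = (- P^-1 Q)^k z 0] ([pencil_orbit], [pencil_unique]).  For
    [z 0 = col_mx u0 u0] the upper half of this solution is [M(k) u0], which
    gives uniqueness.

    Existence needs that the solution [z] starting at [col_mx u0 u0] really is
    of the form [col_mx (x k) (x (- k))].  Exchanging the two halves of a
    vector intertwines [P] and [Q], so [k |-> swap (z (- k))] solves the same
    equation ([pencil_reflect]); it has the same initial value, because
    [col_mx u0 u0] is invariant under the exchange, and hence equals [z]. *)

Definition pencil_solution (K : fieldType) (m p : nat) (P Q : 'M[K]_m)
    (z : int -> 'M[K]_(m, p)) : Prop :=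
  forall k : int, P *m z (k + 1) + Q *m z k = 0.

Lemma pencil_orbit (K : fieldType) (m p : nat) (P Q : 'M[K]_m.+1)
    (z0 : 'M[K]_(m.+1, p)) :
  P \in unitmx -> Q \in unitmx ->
  pencil_solution P Q (fun k => (- (invmx P *m Q)) ^ k *m z0).
Proof.
move=> uP uQ k.
(* Invertibility of the base makes the power at k + 1 the base times the power
   at k also for negative k; this is where Q has to be invertible. *)
have uS : - (invmx P *m Q) \is a GRing.unit.
  by rewrite unitrN -[_ \is a _]/(_ \in unitmx) unitmx_mul unitmx_inv uP.
rewrite addrC [k + 1]addrC exprzDr // expr1z -[_ * _]/(_ *m _).
by rewrite -mulmxA mulNmx mulmxN -[in P *m _]mulmxA mulKVmx // subrr.
Qed.

(** Invertibility of [P] determines [z] forwards in time, that of [Q]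
    backwards. *)
Lemma pencil_unique (K : fieldType) (m p : nat) (P Q : 'M[K]_m)
    (z z' : int -> 'M[K]_(m, p)) :
  P \in unitmx -> Q \in unitmx ->
  pencil_solution P Q z -> pencil_solution P Q z' -> z 0 = z' 0 -> z =1 z'.
Proof.
move=> uP uQ hz hz' h0; elim/int_rect => [|k IHk|k IHk] //.
- have := hz k; rewrite IHk -(hz' k) => /addIr /(can_inj (mulKmx uP)).
  by rewrite -PoszD addn1.
- have := hz (- k.+1%:Z); have := hz' (- k.+1%:Z).
  have -> : - k.+1%:Z + 1 = - k%:Z by rewrite -addn1 PoszD opprD addrNK.
  by rewrite IHk => <- /addrI /(can_inj (mulKmx uQ)).
Qed.

Definition swap_halves (K : fieldType) (n p : nat) (z : 'M[K]_(n + n, p)) :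
  'M[K]_(n + n, p) := col_mx (dsubmx z) (usubmx z).

(** The two coefficients of the doubled equation are exchanged by swapping
    both block rows and block columns, which undoes the exchange of [k] and
    [k + 1] caused by reversing time. *)
Lemma pencil_reflect (K : fieldType) (n p : nat) (F G A B : 'M[K]_n)
    (z : int -> 'M[K]_(n + n, p)) :
  pencil_solution (block_mx F G B A) (block_mx A B G F) z ->
  pencil_solution (block_mx F G B A) (block_mx A B G F)
    (fun k => swap_halves (z (- k))).
Proof.
move=> hz k; have := hz (- k - 1); rewrite addrNK opprD.
rewrite -{1}[z (- k)]vsubmxK -{1}[z (- k - 1)]vsubmxK /swap_halves.
rewrite !mul_block_col !add_col_mx -!col_mx0 => /eq_col_mx [e1 e2].
congr col_mx; [rewrite -[RHS]e2 | rewrite -[RHS]e1];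
  by rewrite [RHS](AC (2 * 2) ((4 * 3) * (2 * 1))).
Qed.

(** The equation at [k] and the equation at [- k - 1] involve the same four
    vectors; they are the two block rows. *)
Lemma is_solution_pair (K : fieldType) (n : nat) (F G A B : 'M[K]_n.+1)
    (x : int -> 'cV[K]_n.+1) :
  is_solution F G A B x <->
  pencil_solution (block_mx F G B A) (block_mx A B G F)
    (fun k => col_mx (x k) (x (- k))).
Proof.
split=> hx k.
  rewrite !mul_block_col add_col_mx -col_mx0 opprD.
  congr col_mx; first by rewrite addrA hx.
  have := hx (- k - 1); rewrite addrNK opprD !opprK addrK => e.
  by rewrite -[RHS]e [RHS](AC (3 * 1) ((4 * 3) * (2 * 1))).
have := hx k; rewrite !mul_block_col add_col_mx -col_mx0 opprD.
by case/eq_col_mx => + _; rewrite addrA.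
Qed.

(** Adding the two upper blocks of a power amounts to applying it to a vector
    with equal halves, which is the doubled initial state as [x 0 = x (- 0)]. *)
Lemma fund_mx_mul (K : fieldType) (n : nat) (F G A B : 'M[K]_n.+1) (k : int)
    (u : 'cV[K]_n.+1) :
  fund_mx F G A B k *m u = usubmx (step_mx_pow F G A B k *m col_mx u u).
Proof.
by rewrite -[in RHS](submxK (step_mx_pow _ _ _ _ _)) mul_block_col col_mxKu -mulmxDl.
Qed.

Theorem theorem4p3 (K : fieldType) (n : nat) (A B F G : 'M[K]_n.+1)
    (hP : block_mx F G B A \in unitmx)
    (hQ : block_mx A B G F \in unitmx) :
  is_fundamental_matrix F G A B (fund_mx F G A B) /\
  forall u0 : 'cV[K]_n.+1,
    [/\ is_solution F G A B (fun k => fund_mx F G A B k *m u0),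
        fund_mx F G A B 0 *m u0 = u0
      & forall x : int -> 'cV[K]_n.+1,
          is_solution F G A B x -> x 0 = u0 ->
          forall k : int, x k = fund_mx F G A B k *m u0].
Proof.
pose z (u : 'cV[K]_n.+1) k := step_mx_pow F G A B k *m col_mx u u.
have hz u : pencil_solution (block_mx F G B A) (block_mx A B G F) (z u).
  (* The size is given as (n + n.+1).+1, at which the ring power is formed;
     it is only convertible to n.+1 + n.+1. *)
  exact: (@pencil_orbit K (n + n.+1) 1 _ _ (col_mx u u) hP hQ).
have z0 u : z u 0 = col_mx u u by rewrite /z /step_mx_pow expr0z -[1]/1%:M mul1mx.
have fundE u k : fund_mx F G A B k *m u = usubmx (z u k) by apply: fund_mx_mul.
(* Both z and its time reversal with swapped halves start at col_mx u u, so
   they coincide: the lower half of z at k is the upper half at - k. *)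
have zsym u k : z u k = col_mx (usubmx (z u k)) (usubmx (z u (- k))).
  have e := pencil_unique hP hQ (hz u) (pencil_reflect (hz u)).
  rewrite -[LHS]vsubmxK; congr col_mx.
  by rewrite e ?col_mxKd // oppr0 z0 /swap_halves col_mxKu col_mxKd.
have sol u : is_solution F G A B (fun k => fund_mx F G A B k *m u).
  by apply/is_solution_pair => k; rewrite !fundE -!zsym; apply: hz.
split=> // u0; split=> // [|x hx hx0 k].
  by rewrite fundE z0 col_mxKu.
have /(pencil_unique hP hQ)/(_ (hz u0)) := (is_solution_pair _ _ _ _ _).1 hx.
by rewrite oppr0 hx0 z0 fundE => /(_ erefl k) <-; rewrite col_mxKu.
Qed.
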